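(* Let $\bigwedge_{\ast}$ be a complex Grassmann algebra (generated by finitely or countably many odd generators $\zeta_1,\zeta_2,\dots$), with even part $\bigwedge_{\ast}^{0}$ and odd part $\bigwedge_{\ast}^{1}$. Let $z$ be an even formal variable and $\theta$ an odd formal variable (so $\theta^2=0$ and $\theta$ anticommutes with $\bigwedge_{\ast}^{1}$). For $j\in\mathbb{Z}$ consider the vector fields $$\mathcal{L}^{(1)}_{j}=-z^{j+1}\frac{\partial}{\partial z}-\left(\frac{j+1}{2}\right)\theta z^{j}\frac{\partial}{\partial\theta},\qquad \mathcal{G}_{j+\frac{1}{2}}=-z^{j+1}\left(\frac{\partial}{\partial\theta}-\theta\frac{\partial}{\partial z}\right),$$ where $\partial/\partial\theta$ is the (odd) left derivative. Let $A_{j}\in\bigwedge_{\ast}^{0}$ and $M_{j+\frac{1}{2}}\in\bigwedge_{\ast}^{1}$ for $j\in\mathbb{Z}_{<0}$ be arbitrary sequences, and define the operator $$E_{A,M}=\exp\left(-\sum_{j\in\mathbb{Z}_{<0}}\left(A_{j}\mathcal{L}^{(1)}_{j}+M_{j+\frac{1}{2}}\mathcal{G}_{j+\frac{1}{2}}\right)\right)$$ acting on $(\bigwedge_{\ast}z[[z^{-1}]][\theta])^{0}\oplus(\bigwedge_{\ast}z[[z^{-1}]][\theta])^{1}$. Set $(\tilde z,\tilde\theta)=E_{A,M}\cdot(z,\theta)$, where $E_{A,M}$ acts on each component separately. Then, with $D=\frac{\partial}{\partial\theta}+\theta\frac{\partial}{\partial z}$, one has $$D\tilde z=\tilde\theta\,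 D\tilde\theta,$$ i.e. $(\tilde z,\tilde\theta)$ is a formal $\mathcal{N}=1$ superconformal map.
   Context: A pair $(\tilde z,\tilde\theta)$ of an even and an odd formal superfunction of $(z,\theta)$ is called ($\mathcal{N}=1$) superconformal if the odd derivative $D=\partial_\theta+\theta\partial_z$ transforms homogeneously of degree one, which is equivalent to $D\tilde z=\tilde\theta D\tilde\theta$. The superscripts $0,1$ denote the even and odd parts of the $\mathbb{Z}_2$-graded algebra $\bigwedge_{\ast}z[[z^{-1}]][\theta]$ (grading from the Grassmann algebra together with $\theta$ odd, $z$ even). *)

(* Defs.v *)
From mathcomp Require Import all_boot all_algebra finmap.
From mathcomp Require Import complex.
From mathcomp Require Import classical_sets fsbigop reals.

Set Implicit Arguments.
Unset Strict Implicit.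
Unset Printing Implicit Defensive.

Import GRing.Theory.
Local Open Scope ring_scope.

Section Super.
Variable R : realType.
Definition Cx := R[i].

(* Grassmann algebra on the odd generators zeta_0, zeta_1, ... (indexed by *)
(* nat).  An element is given by its coefficient on each monomial           *)
(* zeta_S := zeta_{s1} ... zeta_{sk} (s1 < ... < sk), S a finite set.       *)
(* The type [grass] is the formal completion; genuine elements of the      *)
(* Grassmann algebra are the finitely supported ones (see [grass_elt]).    *)
Definition grass := {fset nat} -> Cx.

Definition g0 : grass := fun _ => 0.
Definition g1 : grass := fun S => (S == fset0)%:R.
Definition gadd (a b : grass) : grass := fun S => a S + b S.
Definition gscale (c : Cx) (a : grass) : grass := fun S => c * a S.

(* number of inversions: zeta_T zeta_U = (-1)^(ginv T U) zeta_(T :|: U) *)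
Definition ginv (T U : {fset nat}) : nat :=
  (\sum_(t <- T) \sum_(u <- U) (u < t))%N.

Definition gmul (a b : grass) : grass := fun S =>
  \sum_(T <- fpowerset S)
     (-1) ^+ ginv T (S `\` T)%fset * a T * b (S `\` T)%fset.

Definition gpar (a : grass) : grass := fun S => (-1) ^+ #|` S| * a S.

Definition grass_even (a : grass) := forall S : {fset nat}, odd #|` S| -> a S = 0.
Definition grass_odd (a : grass) := forall S : {fset nat}, ~~ odd #|` S| -> a S = 0.

(* [ngen = Some n]: n generators zeta_0..zeta_(n-1); [None]: countably many *)
Definition gen_ok (ngen : option nat) (i : nat) : bool :=
  if ngen is Some n then (i < n)%N else true.

Definition grass_elt (ngen : option nat) (a : grass) :=
  (exists F : seq {fset nat}, forall S, S \notin F -> a S = 0) /\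
  (forall S, a S != 0 -> forall i, i \in S -> gen_ok ngen i).

(* Formal Laurent series in z with Grassmann coefficients: k |-> coeff of z^k *)
Definition lser := int -> grass.

Definition ladd (f g : lser) : lser := fun k => gadd (f k) (g k).
Definition lscale (c : Cx) (f : lser) : lser := fun k => gscale c (f k).
Definition lzpow (n : int) (f : lser) : lser := fun k => f (k - n).
Definition ldz (f : lser) : lser := fun k => gscale ((k + 1)%:~R) (f (k + 1)).
Definition lgmul (a : grass) (f : lser) : lser := fun k => gmul a (f k).
Definition lpar (f : lser) : lser := fun k => gpar (f k).
(* product of series (a formal sum, finite for series bounded above in z) *)
Definition lmul (f g : lser) : lser := fun k S =>
  \sum_(i \in [set: int]) gmul (f i) (g (k - i)) S.

(* Superfunctions f = f.1 + theta * f.2  (theta written on the left).      *)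
Definition sfun := (lser * lser)%type.

Definition sadd (f g : sfun) : sfun := (ladd f.1 g.1, ladd f.2 g.2).
Definition sscale (c : Cx) (f : sfun) : sfun := (lscale c f.1, lscale c f.2).
Definition szpow (n : int) (f : sfun) : sfun := (lzpow n f.1, lzpow n f.2).
Definition stheta (f : sfun) : sfun := (fun _ => g0, f.1).
(* left multiplication by a Grassmann element a:
   a (f0 + theta f1) = a f0 + theta (gpar a) f1 *)
Definition sgmul (a : grass) (f : sfun) : sfun := (lgmul a f.1, lgmul (gpar a) f.2).
Definition sdz (f : sfun) : sfun := (ldz f.1, ldz f.2).
Definition sdtheta (f : sfun) : sfun := (f.2, fun _ => g0).
(* product of superfunctions (theta^2 = 0, theta anticommutes with odd elements):
   (f0 + theta f1)(g0 + theta g1) = f0 g0 + theta ((gpar f0) g1 + f1 g0) *)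
Definition smul (f g : sfun) : sfun :=
  (lmul f.1 g.1, ladd (lmul (lpar f.1) g.2) (lmul f.2 g.1)).
Definition ssum (I : choiceType) (A : set I) (F : I -> sfun) : sfun :=
  (fun k S => \sum_(i \in A) (F i).1 k S, fun k S => \sum_(i \in A) (F i).2 k S).

Definition sz : sfun := (fun k => if k == 1 then g1 else g0, fun _ => g0).
Definition sth : sfun := (fun _ => g0, fun k => if k == 0 then g1 else g0).

Definition sD (f : sfun) : sfun := sadd (sdtheta f) (stheta (sdz f)).

Definition Lvf (j : int) (f : sfun) : sfun :=
  sadd (sscale (-1) (szpow (j + 1) (sdz f)))
       (sscale (- ((j + 1)%:~R / 2)) (stheta (szpow j (sdtheta f)))).

Definition Gvf (j : int) (f : sfun) : sfun :=
  sscale (-1) (szpow (j + 1) (sadd (sdtheta f) (sscale (-1) (stheta (sdz f))))).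

Definition Xop (A M : int -> grass) (f : sfun) : sfun :=
  sscale (-1) (ssum [set j : int | j < 0]
                    (fun j => sadd (sgmul (A j) (Lvf j f)) (sgmul (M j) (Gvf j f)))).

Definition Eop (A M : int -> grass) (f : sfun) : sfun :=
  ssum [set: nat] (fun n => sscale (n`!%:R)^-1 (iter n (Xop A M) f)).

End Super.

(* Main.v *)
Require Import Defs.
From mathcomp Require Import all_boot all_order all_algebra finmap.
From mathcomp Require Import complex.
From mathcomp Require Import boolp classical_sets functions fsbigop reals.
From mathcomp Require Import ring zify.

(** The exponent is a vector field [X f = (a f0' + m f1) + theta (a f1' + m f0' +
    a' f1 / 2)] on [f = f0 + theta f1], where [a = \sum_(j < 0) A_j z^(j+1)] is even
    and [m = \sum_(j < 0) M_j z^(j+1)] is odd.  With [h = a'/2 + theta m'] and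
    [Y = X + h] one has [D X = Y D] and [Y (u v) = (X u) v + u (Y v)].  Starting from
    [D z = theta (D theta)], induction on [n] gives the Leibniz formula
    [D (X^n z) = \sum_(i <= n) 'C(n, i) (X^i theta) (D (X^(n-i) theta))]; dividing by
    [n!] and summing yields [D (e^X z) = (e^X theta) (D (e^X theta))].
    All sums are finite in each coefficient, since [X] lowers by at least [1] the
    weight for which [z] has weight [2] and [theta] has weight [1]. *)

Set Implicit Arguments.
Unset Strict Implicit.
Unset Printing Implicit Defensive.

Import Order.TTheory GRing.Theory Num.Theory.
Local Open Scope ring_scope.

(** * Sums over the subsets of a finite set *)

Section FsetSums.
Local Open Scope fset_scope.
Variables (K : choiceType) (V : nmodType).
Implicit Types A B S T U : {fset K}.

Lemma perm_fsetU A B : [disjoint A & B] -> perm_eq (A `|` B) (A ++ B).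
Proof.
move=> dAB; apply: uniq_perm; rewrite ?fset_uniq //; last first.
  by move=> x; rewrite mem_cat in_fsetU.
rewrite cat_uniq !fset_uniq andbT /=; apply/hasPn => x xB /=.
by apply/negP => xA; move/fdisjointP: dAB => /(_ x xA); rewrite xB.
Qed.

Lemma fsetUDK S T : T `<=` S -> T `|` (S `\` T) = S.
Proof. by move=> /fsetIidPr TS; rewrite -{1}TS fsetID. Qed.

Lemma fdisjointXDS S T : [disjoint T & S `\` T].
Proof. by apply/fdisjointP => x xT; rewrite in_fsetD xT. Qed.

(** Complementation in [S] is an involution of the powerset. In a coefficient of [gmul] it exchanges
    the blocks given to the two factors, which is what the commutation rules need. *)
Lemma sum_fpowersetC S (F : {fset K} -> V) :
  \sum_(T <- fpowerset S) F T = \sum_(T <- fpowerset S) F (S `\` T).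
Proof.
rewrite -(big_map (fun T => S `\` T) xpredT F); apply: perm_big.
have invol T : T \in fpowerset S -> S `\` (S `\` T) = T.
  by rewrite fpowersetE => TS; rewrite fsetDK.
apply: uniq_perm; rewrite ?fset_uniq //.
  rewrite map_inj_in_uniq ?fset_uniq // => T U TS US eqTU.
  by rewrite -(invol T) // eqTU invol.
move=> T; apply/idP/mapP => [TS|[U US ->]]; last by rewrite fpowersetE fsubsetDl.
by exists (S `\` T); rewrite ?invol // fpowersetE fsubsetDl.
Qed.

Lemma sum_fpowerset_sub S T (F : {fset K} -> V) : T `<=` S ->
  \sum_(U <- fpowerset T) F U = \sum_(U <- fpowerset S | U `<=` T) F U.
Proof.
move=> TS; rewrite -[RHS]big_filter; apply: perm_big.
apply: uniq_perm; rewrite ?fset_uniq ?filter_uniq ?fset_uniq // => U.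
rewrite mem_filter !fpowersetE; case: (boolP (U `<=` T)) => //= UT.
by rewrite (fsubset_trans UT).
Qed.

Lemma sum_fpowerset_sup S U (F : {fset K} -> V) : U `<=` S ->
  \sum_(T <- fpowerset S | U `<=` T) F T =
  \sum_(W <- fpowerset (S `\` U)) F (U `|` W).
Proof.
move=> US; rewrite -(big_map (fsetU U) xpredT F) -[LHS]big_filter; apply: perm_big.
have invol W : W \in fpowerset (S `\` U) -> (U `|` W) `\` U = W.
  rewrite fpowersetCE => /andP[_ dWU].
  by rewrite fsetDUl fsetDv fset0U; apply/fsetDidPl.
apply: uniq_perm; rewrite ?filter_uniq ?fset_uniq //.
  rewrite map_inj_in_uniq ?fset_uniq // => W W' WS W'S eqW.
  by rewrite -(invol W) // eqW invol.
move=> T; rewrite mem_filter fpowersetE; apply/andP/mapP => [[UT TS]|[W]].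
  exists (T `\` U); last by rewrite fsetUDK.
  by rewrite fpowersetE fsetSD.
rewrite fpowersetCE => /andP[WS _] ->.
by rewrite fsubsetUl fsubUset US WS.
Qed.

(** Both sides run over the ordered splittings of [S] into three disjoint blocks: the left one cuts
    off the last block first, the right one the first block. This is the combinatorial core of
    associativity in the Grassmann algebra. *)
Lemma sum_fpowerset_assoc S (F : {fset K} -> {fset K} -> {fset K} -> V) :
  \sum_(T <- fpowerset S) \sum_(U <- fpowerset T) F U (T `\` U) (S `\` T) =
  \sum_(U <- fpowerset S) \sum_(W <- fpowerset (S `\` U))
     F U W (S `\` U `\` W).
Proof.
transitivity (\sum_(T <- fpowerset S) \sum_(U <- fpowerset S | U `<=` T)
    F U (T `\` U) (S `\` T)).
  by apply: eq_big_seq => T; rewrite fpowersetE => /sum_fpowerset_sub ->.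
rewrite (exchange_big_dep xpredT) //=; apply: eq_big_seq => U.
rewrite fpowersetE => US; rewrite sum_fpowerset_sup //.
apply: eq_big_seq => W; rewrite fpowersetCE => /andP[_ dWU].
by rewrite fsetDUl fsetDv fset0U (fsetDidPl _ _ dWU) fsetDDl.
Qed.

End FsetSums.

(** * The Grassmann algebra: associativity, parity and signed commutation *)

Section Grassmann.
Variable R : realType.
Implicit Types (a b c : grass R) (x : Cx R) (S T U W : {fset nat}).

Lemma ginvUl T U W : [disjoint T & U]%fset ->
  ginv (T `|` U)%fset W = (ginv T W + ginv U W)%N.
Proof. by move=> dTU; rewrite /ginv (perm_big _ (perm_fsetU dTU)) big_cat. Qed.

Lemma ginvUr T U W : [disjoint U & W]%fset ->
  ginv T (U `|` W)%fset = (ginv T U + ginv T W)%N.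
Proof.
move=> dUW; rewrite /ginv -big_split /=; apply: eq_bigr => t _.
by rewrite (perm_big _ (perm_fsetU dUW)) big_cat.
Qed.

(** Disjointness excludes [t = u], so each pair in the product of [T] and [U] is an inversion for
    exactly one of the two orders. *)
Lemma ginvC T U : [disjoint T & U]%fset ->
  (ginv T U + ginv U T)%N = (#|` T| * #|` U|)%N.
Proof.
move=> dTU; rewrite /ginv [X in (_ + X)%N]exchange_big /= -big_split /=.
transitivity (\sum_(t <- T) #|` U|)%N; last first.
  by rewrite big_const_seq count_predT iter_addn_0 mulnC.
apply: eq_big_seq => t tT; rewrite -big_split /=.
transitivity (\sum_(u <- U) 1)%N; last by rewrite sum1_size.
apply: eq_big_seq => u uU; have : t != u.
  by apply/eqP => tu; move/fdisjointP: dTU => /(_ _ tT); rewrite tu uU.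
by case: ltngtP.
Qed.

Lemma grassDE a b S : (a + b) S = a S + b S.
Proof. by []. Qed.

Lemma gmulDl a b c : gmul (a + b) c = gmul a c + gmul b c.
Proof.
apply/funext => S; rewrite /gmul [RHS]/GRing.add /= -big_split /=.
by apply: eq_bigr => T _; rewrite [(a + b) T]/GRing.add /=; ring.
Qed.

Lemma gmulDr a b c : gmul a (b + c) = gmul a b + gmul a c.
Proof.
apply/funext => S; rewrite /gmul [RHS]/GRing.add /= -big_split /=.
by apply: eq_bigr => T _; rewrite [(b + c) _]/GRing.add /=; ring.
Qed.

Lemma gmul0l a : gmul 0 a = 0.
Proof. by apply/funext => S; rewrite /gmul big1 // => T _; rewrite mulr0 mul0r. Qed.

Lemma gmul0r a : gmul a 0 = 0.
Proof. by apply/funext => S; rewrite /gmul big1 // => T _; rewrite mulr0. Qed.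

Lemma gmulZl x a b : gmul (gscale x a) b = gscale x (gmul a b).
Proof.
apply/funext => S; rewrite /gmul /gscale mulr_sumr.
by apply: eq_bigr => T _; ring.
Qed.

Lemma gmulZr x a b : gmul a (gscale x b) = gscale x (gmul a b).
Proof.
apply/funext => S; rewrite /gmul /gscale mulr_sumr.
by apply: eq_bigr => T _; ring.
Qed.

Lemma gmul_suml (I : Type) (r : seq I) (F : I -> grass R) b :
  gmul (\sum_(i <- r) F i) b = \sum_(i <- r) gmul (F i) b.
Proof. by elim: r => [|i r IH]; rewrite ?big_nil ?gmul0l // !big_cons gmulDl IH. Qed.

Lemma gmul_sumr (I : Type) (r : seq I) (F : I -> grass R) b :
  gmul b (\sum_(i <- r) F i) = \sum_(i <- r) gmul b (F i).
Proof. by elim: r => [|i r IH]; rewrite ?big_nil ?gmul0r // !big_cons gmulDr IH. Qed.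

Lemma gmul1l a : gmul (g1 R) a = a.
Proof.
apply/funext => S; rewrite /gmul (bigD1_seq (fset0 : {fset nat})) ?fset_uniq //=.
  rewrite big1 => [|T /negPf]; last by rewrite /g1 => ->; rewrite mulr0 mul0r.
  by rewrite addr0 /g1 eqxx fsetD0 /ginv big_seq_fset0 expr0 !mul1r.
by rewrite fpowersetE fsub0set.
Qed.

(** Inversion numbers are additive over disjoint unions, so for blocks [U], [W], [Z] either
    bracketing gives the symmetric exponent [ginv U W + ginv U Z + ginv W Z]. *)
Lemma gmulA a b c : gmul a (gmul b c) = gmul (gmul a b) c.
Proof.
apply/funext => S; rewrite /gmul.
transitivity (\sum_(U <- fpowerset S) \sum_(W <- fpowerset (S `\` U)%fset)
   (-1) ^+ (ginv U W + ginv U (S `\` U `\` W)%fset + ginv W (S `\` U `\` W)%fset)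
     * a U * b W * c (S `\` U `\` W)%fset).
  apply: eq_bigr => U _; rewrite mulr_sumr; apply: eq_big_seq => W.
  rewrite fpowersetE => WS; rewrite -ginvUr ?fdisjointXDS //.
  by rewrite fsetUDK // exprD; ring.
rewrite -(sum_fpowerset_assoc S (fun U W Z =>
   (-1) ^+ (ginv U W + ginv U Z + ginv W Z) * a U * b W * c Z)).
apply: eq_big_seq => T; rewrite fpowersetE => TS.
rewrite mulr_sumr mulr_suml; apply: eq_big_seq => U; rewrite fpowersetE => UT.
rewrite -addnA -ginvUl ?fdisjointXDS // fsetUDK //.
by rewrite exprD; ring.
Qed.

Lemma gparM a b : gpar (gmul a b) = gmul (gpar a) (gpar b).
Proof.
apply/funext => S; rewrite /gmul /gpar mulr_sumr.
apply: eq_big_seq => T; rewrite fpowersetE => TS.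
by rewrite -(cardfsID T S) (fsetIidPr TS) exprD; ring.
Qed.

Lemma gpar_even a : grass_even a -> gpar a = a.
Proof.
move=> ea; apply/funext => S; rewrite /gpar -signr_odd.
by have [/ea ->|_] := boolP (odd _); rewrite ?mulr0 // mul1r.
Qed.

Lemma gpar_odd a : grass_odd a -> gpar a = gscale (-1) a.
Proof.
move=> oa; apply/funext => S; rewrite /gpar /gscale -signr_odd.
by have [_|/oa ->] := boolP (odd _); rewrite ?mulr0 // expr1.
Qed.

(** Only blocks [T] of even size contribute from [a]; by [ginvC] the two inversion numbers then add
    up to an even number, so the two signs agree. *)
Lemma gmulC_even a b : grass_even a -> gmul b a = gmul a b.
Proof.
move=> ea; apply/funext => S; rewrite /gmul sum_fpowersetC.
apply: eq_big_seq => T; rewrite fpowersetE => TS; rewrite fsetDK //.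
have [/ea ->|eT] := boolP (odd #|` T|); first by rewrite !mulr0 mul0r.
have /(congr1 odd) := ginvC (fdisjointXDS S T).
rewrite oddD oddM (negPf eT) /= => /addbP e.
rewrite -(signr_odd _ (ginv T _)) -(signr_odd _ (ginv (S `\` T)%fset _)).
have -> : odd (ginv (S `\` T)%fset T) = odd (ginv T (S `\` T)%fset).
  by move: e; do 2!case: odd.
by ring.
Qed.

(** For a block [T] of odd size, [ginvC] shows that the two signs differ by the parity of the
    complementary block, which is the sign that [gpar] puts on [b]. *)
Lemma gmulC_odd a b : grass_odd a -> gmul b a = gmul a (gpar b).
Proof.
move=> oa; apply/funext => S; rewrite /gmul /gpar sum_fpowersetC.
apply: eq_big_seq => T; rewrite fpowersetE => TS; rewrite fsetDK //.
have [oT|/oa ->] := boolP (odd #|` T|); last by rewrite !mulr0 mul0r.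
have /(congr1 odd) := ginvC (fdisjointXDS S T).
rewrite oddD oddM oT /= => /esym e.
rewrite -(signr_odd _ (ginv (S `\` T)%fset _)) -(signr_odd _ (ginv T _)).
rewrite -(signr_odd _ #|` _|) e signr_addb.
by case: (odd (ginv T _)); rewrite /= ?expr1 ?expr0; ring.
Qed.

End Grassmann.

(** * Finitely supported sums over the integers, cut to symmetric windows *)

Definition zball (n : nat) : seq int := [seq i%:Z - n%:Z | i <- iota 0 n.*2.+1].

Lemma mem_zball n (i : int) : (i \in zball n) = (`|i| <= n)%N.
Proof.
apply/mapP/idP => [[j]|le_in]; first by rewrite mem_iota; lia.
by exists (absz (i + n%:Z)); rewrite ?mem_iota; lia.
Qed.

Lemma zball_uniq n : uniq (zball n).
Proof. by rewrite map_inj_uniq ?iota_uniq // => i j; lia. Qed.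

Lemma fsum_zball (V : nmodType) (F : int -> V) n :
  (forall i : int, (n < `|i|)%N -> F i = 0) ->
  \sum_(i \in [set: int]) F i = \sum_(i <- zball n) F i.
Proof.
move=> F0; rewrite (fsbigE (zball n)) ?zball_uniq //; last first.
  by move=> i _; rewrite mem_zball -ltnNge => /F0.
by apply: eq_bigl => i; rewrite in_setT.
Qed.

(** The bijection need not preserve the window; the two truncated sums are compared through the full
    sum over [int], which both equal because both supports fit in the window. *)
Lemma zball_reindex (V : nmodType) (h : int -> int) (F : int -> V) n :
  bijective h -> (forall i : int, (n < `|i|)%N -> F i = 0) ->
  (forall i : int, (n < `|i|)%N -> F (h i) = 0) ->
  \sum_(i <- zball n) F i = \sum_(i <- zball n) F (h i).
Proof.
by move=> hbij F0 Fh0; rewrite -!fsum_zball //; apply: reindex_fsbigT.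
Qed.

(** * Laurent series bounded above in [z], with their product, derivative and parity *)

Section LaurentSeries.
Variable R : realType.
Implicit Types (f g h : lser R) (k b c d : int) (x : Cx R).

Definition lbnd b f := forall k, b < k -> f k = 0.

Lemma lserDE f g k S : (f + g) k S = f k S + g k S.
Proof. by []. Qed.

Lemma lscaleE x f k S : lscale x f k S = x * f k S.
Proof. by []. Qed.

Lemma laddE f g : ladd f g = f + g.
Proof. by []. Qed.

Lemma lbndD b f g : lbnd b f -> lbnd b g -> lbnd b (f + g).
Proof. by move=> bf bg k bk; rewrite /GRing.add /= bf // bg // addr0. Qed.

Lemma lbndW b c f : b <= c -> lbnd b f -> lbnd c f.
Proof. by move=> bc bf k ck; apply: bf; lia. Qed.

Lemma gscale0 x : gscale x 0 = 0 :> grass R.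
Proof. by apply/funext => S; rewrite /gscale mulr0. Qed.

Lemma lbnd_scale b x f : lbnd b f -> lbnd b (lscale x f).
Proof. by move=> bf k bk; rewrite /lscale bf // gscale0. Qed.

Lemma lbnd_dz b f : lbnd b f -> lbnd b (ldz f).
Proof. by move=> bf k bk; rewrite /ldz bf ?gscale0 //; lia. Qed.

Lemma lbnd_par b f : lbnd b f -> lbnd b (lpar f).
Proof.
by move=> bf k bk; apply/funext => S; rewrite /lpar /gpar bf //; apply: mulr0.
Qed.

Lemma lmul_eq0 f g k :
  (forall i : int, f i = 0 \/ g (k - i) = 0) -> lmul f g k = 0.
Proof.
move=> fg0; apply/funext => S; rewrite /lmul fsbig1 // => i _.
by case: (fg0 i) => ->; rewrite ?gmul0l ?gmul0r.
Qed.

Lemma lbnd_mul b c f g : lbnd b f -> lbnd c g -> lbnd (b + c) (lmul f g).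
Proof.
move=> bf cg k bck; apply: lmul_eq0 => i.
by case: (ltP b i) => bi; [left; apply: bf | right; apply: cg; lia].
Qed.

(** A nonzero term needs [i <= b] and [k - i <= c], so [i] lies between [k - c] and [b], inside the
    window. *)
Lemma lmulE b c n f g k : lbnd b f -> lbnd c g ->
  (`|b| + `|c| + `|k| <= n)%N ->
  lmul f g k = \sum_(i <- zball n) gmul (f i) (g (k - i)).
Proof.
move=> bf cg le_n; apply/funext => S; rewrite /lmul (@fsum_zball _ _ n).
  by rewrite fct_sumE.
move=> i ni; case: (ltP b i) => bi; first by rewrite bf // gmul0l.
by rewrite cg ?gmul0r //; lia.
Qed.

Lemma lmulE_shift b c n f g k d : lbnd b f -> lbnd c g ->
  (`|b| + `|c| + `|k| + `|d| <= n)%N ->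
  lmul f g k = \sum_(i <- zball n) gmul (f (i + d)) (g (k - (i + d))).
Proof.
move=> bf cg le_n; rewrite (@lmulE b c n) //; last by lia.
apply: (@zball_reindex _ (fun i => i + d) (fun i => gmul (f i) (g (k - i)))).
- by exists (fun i => i - d) => i; rewrite ?addrK ?subrK.
- move=> i ni; case: (ltP b i) => bi; first by rewrite bf // gmul0l.
  by rewrite cg ?gmul0r //; lia.
- move=> i ni; case: (ltP b (i + d)) => bi; first by rewrite bf // gmul0l.
  by rewrite cg ?gmul0r //; lia.
Qed.

Definition lfin f := exists b, lbnd b f.

Lemma lfin_common f g : lfin f -> lfin g -> exists b, lbnd b f /\ lbnd b g.
Proof.
move=> [b bf] [c cg]; exists (`|b| + `|c|)%N%:Z.
by split; [apply: lbndW bf|apply: lbndW cg]; lia.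
Qed.

Lemma lfinD f g : lfin f -> lfin g -> lfin (f + g).
Proof.
move=> ff fg; have [b [bf bg]] := lfin_common ff fg.
by exists b; apply: lbndD.
Qed.

Lemma lfinZ x f : lfin f -> lfin (lscale x f).
Proof. by move=> [b bf]; exists b; apply: lbnd_scale. Qed.

Lemma lfin_dz f : lfin f -> lfin (ldz f).
Proof. by move=> [b bf]; exists b; apply: lbnd_dz. Qed.

Lemma lfin_par f : lfin f -> lfin (lpar f).
Proof. by move=> [b bf]; exists b; apply: lbnd_par. Qed.

Lemma lfin_mul f g : lfin f -> lfin g -> lfin (lmul f g).
Proof. by move=> [b bf] [c cg]; exists (b + c); apply: lbnd_mul. Qed.

Lemma lmulDl f g h : lfin f -> lfin g -> lfin h ->
  lmul (f + g) h = lmul f h + lmul g h.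
Proof.
move=> ff fg [c ch]; have [b [bf bg]] := lfin_common ff fg.
apply/funext => k; rewrite [RHS]/GRing.add /=.
rewrite !(@lmulE b c (`|b| + `|c| + `|k|)) //; last exact: lbndD.
by rewrite -big_split /=; apply: eq_bigr => i _; rewrite -gmulDl.
Qed.

Lemma lmulDr f g h : lfin f -> lfin g -> lfin h ->
  lmul h (f + g) = lmul h f + lmul h g.
Proof.
move=> ff fg [c ch]; have [b [bf bg]] := lfin_common ff fg.
apply/funext => k; rewrite [RHS]/GRing.add /=.
rewrite !(@lmulE c b (`|c| + `|b| + `|k|)) //; last exact: lbndD.
by rewrite -big_split /=; apply: eq_bigr => i _; rewrite -gmulDr.
Qed.

Lemma lmul0l f : lmul 0 f = 0.
Proof. by apply/funext => k; apply: lmul_eq0; left. Qed.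

Lemma lmul0r f : lmul f 0 = 0.
Proof. by apply/funext => k; apply: lmul_eq0; right. Qed.

Lemma lmulZl x f g : lmul (lscale x f) g = lscale x (lmul f g).
Proof.
apply/funext => k; apply/funext => S.
rewrite /lscale /gscale /lmul mulr_fsumr; apply: eq_fsbigr => i _.
exact: (congr1 (fun u : grass R => u S) (gmulZl x (f i) (g (k - i)))).
Qed.

Lemma lmulZr x f g : lmul f (lscale x g) = lscale x (lmul f g).
Proof.
apply/funext => k; apply/funext => S.
rewrite /lscale /gscale /lmul mulr_fsumr; apply: eq_fsbigr => i _.
exact: (congr1 (fun u : grass R => u S) (gmulZr x (f i) (g (k - i)))).
Qed.

Lemma lmulA f g h : lfin f -> lfin g -> lfin h ->
  lmul f (lmul g h) = lmul (lmul f g) h.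
Proof.
move=> [b bf] [c cg] [d dh]; apply/funext => k.
pose n := (`|b| + `|c| + `|d| + `|k|)%N.
pose N := (`|b| + `|c| + `|d| + `|k| + n + n)%N.
(* Beyond [n] in absolute value, an index [i <= b] is so negative that [k - i] exceeds [c + d], and
   both sides vanish. Within [n], the inner sum is shifted by [- i] so that its index becomes the
   total degree of the first two factors; the two extra [n] in [N] pay for [k - i] and for this
   shift. *)
have split2 i : gmul (f i) (lmul g h (k - i)) =
    \sum_(j <- zball N) gmul (gmul (f i) (g (j - i))) (h (k - j)).
  case: (ltP b i) => bi.
    rewrite bf // gmul0l big1 // => j _; by rewrite !gmul0l.
  case: (leqP (`|i|) n) => ni.
    rewrite (@lmulE_shift c d N _ _ _ (- i)) //; last by rewrite /N /n; lia.
    rewrite gmul_sumr; apply: eq_bigr => j _.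
    by rewrite gmulA; congr (gmul _ (h _)); lia.
  rewrite (lbnd_mul cg dh) ?gmul0r; last by rewrite /n in ni; lia.
  rewrite big1 // => j _; case: (ltP c (j - i)) => cj.
    by rewrite cg // gmul0r gmul0l.
  by rewrite (dh (k - j)) ?gmul0r //; rewrite /n in ni; lia.
rewrite (@lmulE b (c + d) N) //; [|exact: lbnd_mul|by rewrite /N /n; lia].
rewrite (@lmulE (b + c) d N) //; [|exact: lbnd_mul|by rewrite /N /n; lia].
under eq_bigr do rewrite split2; rewrite exchange_big /=; apply: eq_big_seq => j.
rewrite mem_zball -gmul_suml => jN.
case: (leqP (`|j|) n) => nj.
  by congr (gmul _ _); rewrite (@lmulE b c N) // /N /n; lia.
case: (ltP d (k - j)) => dj; first by rewrite dh // !gmul0r.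
rewrite (lbnd_mul bf cg) ?gmul0l; last by rewrite /n in nj; lia.
rewrite big1 ?gmul0l // => i _; case: (ltP b i) => bi; first by rewrite bf // gmul0l.
by rewrite cg ?gmul0r //; rewrite /n in nj; lia.
Qed.

Lemma ldzD f g : ldz (f + g) = ldz f + ldz g.
Proof.
apply/funext => k; apply/funext => S.
by rewrite /ldz /gscale /GRing.add /= mulrDr.
Qed.

Lemma ldzM f g : lfin f -> lfin g ->
  ldz (lmul f g) = lmul (ldz f) g + lmul f (ldz g).
Proof.
move=> [b bf] [c cg]; apply/funext => k; rewrite {1}/ldz [RHS]/GRing.add /=.
pose n := (`|b| + `|c| + `|k| + 1 + 1)%N.
(* The shifts by 1 make all three sums range over the same products [f (i + 1)] times [g (k - i)];
   the product rule is then [(i + 1) + (k - i) = k + 1]. *)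
rewrite (@lmulE_shift b c n f g (k + 1) 1) //; last by rewrite /n; lia.
rewrite (@lmulE b c n (ldz f)) //; [|exact: lbnd_dz|by rewrite /n; lia].
rewrite (@lmulE_shift b c n f (ldz g) k 1) //; [|exact: lbnd_dz|by rewrite /n; lia].
rewrite -big_split /=; apply/funext => S; rewrite /gscale !fct_sumE mulr_sumr.
apply: eq_bigr => i _; rewrite /ldz gmulZl gmulZr.
have -> : k + 1 - (i + 1) = k - i by lia.
have -> : k - (i + 1) + 1 = k - i by lia.
rewrite [RHS]/GRing.add /= /gscale -mulrDl; congr (_ * _).
by rewrite -rmorphD /=; congr (_%:~R); lia.
Qed.

Lemma lparM f g : lpar (lmul f g) = lmul (lpar f) (lpar g).
Proof.
apply/funext => k; apply/funext => S; rewrite /lpar /gpar /lmul mulr_fsumr.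
apply: eq_fsbigr => i _.
exact: (congr1 (fun u : grass R => u S) (gparM (f i) (g (k - i)))).
Qed.

Lemma lparD f g : lpar (f + g) = lpar f + lpar g.
Proof.
apply/funext => k; apply/funext => S.
by rewrite /lpar /gpar /GRing.add /= mulrDr.
Qed.

Lemma lparK f : lpar (lpar f) = f.
Proof.
apply/funext => k; apply/funext => S.
by rewrite /lpar /gpar mulrA -expr2 sqrr_sign mul1r.
Qed.

Lemma lpar_dz f : lpar (ldz f) = ldz (lpar f).
Proof.
apply/funext => k; apply/funext => S.
by rewrite /lpar /ldz /gpar /gscale mulrCA.
Qed.

Lemma lmul_swap f g h :
  (forall i j, gmul (g j) (f i) = gmul (f i) (h j)) -> lmul g f = lmul f h.
Proof.
move=> fgh; apply/funext => k; apply/funext => S; rewrite /lmul.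
rewrite (@reindex_fsbigT _ _ _ _ _ (fun i => k - i)); last first.
  by exists (fun i => k - i) => i; lia.
by apply: eq_fsbigr => i _; rewrite fgh; congr (gmul (f _) _ _); lia.
Qed.

Lemma lmulC_even f g : (forall i, grass_even (f i)) -> lmul g f = lmul f g.
Proof. by move=> ef; apply: lmul_swap => i j; apply: gmulC_even. Qed.

Lemma lmulC_odd f g : (forall i, grass_odd (f i)) -> lmul g f = lmul f (lpar g).
Proof. by move=> ef; apply: lmul_swap => i j; apply: gmulC_odd. Qed.

Lemma lpar_even f : (forall i, grass_even (f i)) -> lpar f = f.
Proof. by move=> ef; apply/funext => k; apply: gpar_even. Qed.

Lemma lpar_odd f : (forall i, grass_odd (f i)) -> lpar f = lscale (-1) f.
Proof. by move=> ef; apply/funext => k; apply: gpar_odd. Qed.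

Lemma ldz_even f : (forall i, grass_even (f i)) -> forall i, grass_even (ldz f i).
Proof. by move=> ef i S oS; rewrite /ldz /gscale ef ?mulr0. Qed.

Lemma ldz_odd f : (forall i, grass_odd (f i)) -> forall i, grass_odd (ldz f i).
Proof. by move=> ef i S oS; rewrite /ldz /gscale ef ?mulr0. Qed.

(** The coefficient of index [k] uses [f] only from [k - c] on and [g] only from [k - b] on. It
    allows the exponential to be replaced by a partial sum inside a product. *)
Lemma lmul_congr b c d f f' g g' k : lbnd b f -> lbnd b f' ->
  lbnd c g -> lbnd c g' -> d + c <= k -> d + b <= k ->
  (forall i, d <= i -> f i = f' i) -> (forall i, d <= i -> g i = g' i) ->
  lmul f g k = lmul f' g' k.
Proof.
move=> bf bf' cg cg' dc db eqf eqg; apply/funext => S.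
apply: eq_fsbigr => i _; case: (ltP b i) => bi.
  by rewrite bf // bf' // !gmul0l.
rewrite eqg; last by lia.
case: (leP d i) => di; first by rewrite eqf.
by rewrite cg' ?gmul0r //; lia.
Qed.

End LaurentSeries.

#[export] Hint Resolve lfinD lfinZ lfin_dz lfin_par lfin_mul : lfin.

(** * Binomial sums and the Cauchy product of finite sums *)

Lemma sum_binomS (V : zmodType) (G : nat -> nat -> V) n :
  \sum_(i < n.+1) (G i.+1 (n - i)%N + G i (n - i).+1) *+ 'C(n, i) =
  \sum_(i < n.+2) G i (n.+1 - i)%N *+ 'C(n.+1, i).
Proof.
under eq_bigr do rewrite mulrnDl.
rewrite big_split /= [RHS]big_ord_recl /= bin0 subn0.
(* Pascal's rule splits the right side into the two families on the left; the one surplus term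
   carries ['C(n, n.+1) = 0]. *)
under [in RHS]eq_bigr do rewrite /bump leq0n add1n subSS binS mulrnDr.
rewrite [in RHS]big_split /= [LHS]addrC [RHS]addrA; congr (_ + _).
rewrite big_ord_recl /= subn0 bin0; congr (_ + _).
rewrite big_ord_recr /= bin_small // mulr0n addr0.
apply: eq_bigr => i _.
by rewrite /bump leq0n add1n subnSK.
Qed.

Lemma sum_triangle (V : nmodType) (G : nat -> nat -> V) N :
  \sum_(n < N) \sum_(i < n.+1) G i (n - i)%N = \sum_(i < N) \sum_(j < N - i) G i j.
Proof.
elim: N => [|N IH]; first by rewrite !big_ord0.
rewrite big_ord_recr /= IH [RHS]big_ord_recr /= subSnn big_ord1.
rewrite [X in _ + X]big_ord_recr /= subnn addrA -big_split /=; congr (_ + _).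
by apply: eq_bigr => i _; rewrite subSn ?big_ord_recr // ltnW.
Qed.

(** The square exceeds the triangle [i + j < N] only by terms that vanish, so a product of two
    partial sums can be regrouped by total degree. *)
Lemma sum_square (V : nmodType) (G : nat -> nat -> V) N :
  (forall i j, (N <= i + j)%N -> G i j = 0) ->
  \sum_(i < N) \sum_(j < N) G i j = \sum_(n < N) \sum_(i < n.+1) G i (n - i)%N.
Proof.
move=> G0; rewrite sum_triangle; apply: eq_bigr => i _.
rewrite -!(big_mkord xpredT (G i)) (big_cat_nat (n := (N - i)%N)) ?leq_subr //=.
rewrite [X in _ + X]big_nat_cond [X in _ + X]big1 ?addr0 // => j.
by rewrite leq_subLR => /andP[/andP[/G0]].
Qed.

Lemma fsum_nat (V : nmodType) (F : nat -> V) N :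
  (forall n, (N <= n)%N -> F n = 0) ->
  \sum_(n \in [set: nat]) F n = \sum_(n < N) F n.
Proof.
move=> F0; rewrite (fsbigE (iota 0 N)) ?iota_uniq //; last first.
  by move=> i _; rewrite mem_iota /= -leqNgt => /F0.
rewrite -(big_mkord xpredT) /index_iota subn0.
by apply: eq_bigl => i; rewrite in_setT.
Qed.

(** * Superfunctions: weights, the odd derivative and the product *)

Section Superfunctions.
Variable R : realType.
Implicit Types (f g u v : sfun R) (w : int) (x : Cx R).

(* The weight of [z^k] is [2k] and that of [theta z^k] is [2k+1]. *)
Definition sbnd w f :=
  (forall k : int, w < k *+ 2 -> f.1 k = 0) /\
  (forall k : int, w < k *+ 2 + 1 -> f.2 k = 0).

Lemma sbnd1 w f : sbnd w f -> lbnd (`|w|%N%:Z) f.1.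
Proof. by move=> [f0 _] k wk; apply: f0; lia. Qed.

Lemma sbnd2 w f : sbnd w f -> lbnd (`|w|%N%:Z) f.2.
Proof. by move=> [_ f1] k wk; apply: f1; lia. Qed.

Lemma sbndW w w' f : w <= w' -> sbnd w f -> sbnd w' f.
Proof. by move=> ww [f0 f1]; split=> k wk; [apply: f0|apply: f1]; lia. Qed.

Lemma sbnd0 w : sbnd w 0.
Proof. by split. Qed.

Lemma sbndD w f g : sbnd w f -> sbnd w g -> sbnd w (f + g).
Proof.
by move=> [f0 f1] [h0 h1]; split=> k wk;
  rewrite /= /GRing.add /= ?f0 ?f1 ?h0 ?h1 ?addr0.
Qed.

Lemma sbnd_sum w (I : Type) (r : seq I) (F : I -> sfun R) :
  (forall i, sbnd w (F i)) -> sbnd w (\sum_(i <- r) F i).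
Proof.
move=> bF; elim: r => [|i r IH]; first by rewrite big_nil; apply: sbnd0.
by rewrite big_cons; apply: sbndD.
Qed.

Lemma sbndMn w f n : sbnd w f -> sbnd w (f *+ n).
Proof.
move=> bf; elim: n => [|n IH]; first exact: sbnd0.
by rewrite mulrS; apply: sbndD.
Qed.

Lemma sbndZ w x f : sbnd w f -> sbnd w (sscale x f).
Proof.
by move=> [f0 f1]; split=> k wk; rewrite /= /lscale ?f0 ?f1 // gscale0.
Qed.

Lemma sDE f : sD f = (f.2, ldz f.1).
Proof.
rewrite /sD /sadd /=; congr (_, _); first exact: (addr0 (f.2 : lser R)).
exact: (add0r (ldz f.1 : lser R)).
Qed.

Lemma sDD f g : sD (f + g) = sD f + sD g.
Proof. by rewrite !sDE /= ldzD. Qed.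

Lemma sD0 : sD 0 = 0 :> sfun R.
Proof. by apply: (addrI (sD 0)); rewrite -sDD !addr0. Qed.

Lemma sDZ x f : sD (sscale x f) = sscale x (sD f).
Proof.
rewrite !sDE /sscale /=; congr (_, _).
by apply/funext => k; apply/funext => S; rewrite /ldz /lscale /gscale mulrCA.
Qed.

Lemma sD_sum (I : Type) (r : seq I) (F : I -> sfun R) :
  sD (\sum_(i <- r) F i) = \sum_(i <- r) sD (F i).
Proof. by elim: r => [|i r IH]; rewrite ?big_nil ?sD0 // !big_cons sDD IH. Qed.

Lemma sbnd_D w f : sbnd w f -> sbnd (w - 1) (sD f).
Proof.
move=> [f0 f1]; rewrite sDE; split=> k wk /=; first by apply: f1; lia.
by rewrite /ldz f0 ?gscale0 //; lia.
Qed.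

Lemma lpar0 (f : lser R) k : f k = 0 -> lpar f k = 0.
Proof.
by move=> fk; apply/funext => S; rewrite /lpar /gpar fk; apply: mulr0.
Qed.

Lemma sbnd_mul w w' f g : sbnd w f -> sbnd w' g -> sbnd (w + w') (smul f g).
Proof.
move=> [f0 f1] [h0 h1]; split=> k wk /=.
  apply: lmul_eq0 => i; case: (ltP w (i *+ 2)) => wi; [left|right].
    exact: f0.
  by apply: h0; lia.
rewrite /ladd !lmul_eq0 ?addr0 //; first exact: addr0.
  move=> i; case: (ltP w (i *+ 2 + 1)) => wi; [left|right].
    exact: f1.
  by apply: h0; lia.
move=> i; case: (ltP w (i *+ 2)) => wi; [left|right].
  by apply/lpar0/f0.
by apply: h1; lia.
Qed.

Lemma sbnd_fin1 w f : sbnd w f -> lfin f.1.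
Proof. by move=> /sbnd1; exists `|w|%N%:Z. Qed.

Lemma sbnd_fin2 w f : sbnd w f -> lfin f.2.
Proof. by move=> /sbnd2; exists `|w|%N%:Z. Qed.

Lemma smulDl w w' f g u : sbnd w f -> sbnd w g -> sbnd w' u ->
  smul (f + g) u = smul f u + smul g u.
Proof.
move=> bf bg bu.
have := (sbnd_fin1 bf, sbnd_fin2 bf, sbnd_fin1 bg, sbnd_fin2 bg).
have := (sbnd_fin1 bu, sbnd_fin2 bu) => -[u1 u2] [[[f1 f2] h1] h2].
rewrite /smul /= lparD; congr (_, _); first by rewrite lmulDl.
rewrite !lmulDl //; try by auto with lfin.
exact: (addrACA (lmul (lpar f.1) u.2 : lser R)).
Qed.

Lemma smulDr w w' f g u : sbnd w f -> sbnd w g -> sbnd w' u ->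
  smul u (f + g) = smul u f + smul u g.
Proof.
move=> bf bg bu.
have := (sbnd_fin1 bf, sbnd_fin2 bf, sbnd_fin1 bg, sbnd_fin2 bg).
have := (sbnd_fin1 bu, sbnd_fin2 bu) => -[u1 u2] [[[f1 f2] h1] h2].
rewrite /smul /=; congr (_, _); first by rewrite lmulDr.
rewrite !lmulDr //; try by auto with lfin.
exact: (addrACA (lmul (lpar u.1) f.2 : lser R)).
Qed.

Lemma smul0l f : smul 0 f = 0.
Proof.
rewrite /smul /= !lmul0l; congr (_, _).
have -> : lpar 0 = 0 :> lser R by apply/funext => k; apply: lpar0.
by rewrite lmul0l; exact: (addr0 (0 : lser R)).
Qed.

Lemma smul0r f : smul f 0 = 0.
Proof.
by rewrite /smul /= !lmul0r; congr (_, _); exact: (addr0 (0 : lser R)).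
Qed.

Lemma lscaleD x (f g : lser R) : lscale x (f + g) = lscale x f + lscale x g.
Proof.
by apply/funext => k; apply/funext => S; rewrite /lscale /gscale /GRing.add /= mulrDr.
Qed.

Lemma smulZl x f g : smul (sscale x f) g = sscale x (smul f g).
Proof.
rewrite /smul /sscale /= !lmulZl; congr (_, _).
have -> : lpar (lscale x f.1) = lscale x (lpar f.1).
  by apply/funext => k; apply/funext => S; rewrite /lpar /gpar /lscale /gscale mulrCA.
by rewrite lmulZl -[LHS]lscaleD.
Qed.

Lemma smulZr x f g : smul f (sscale x g) = sscale x (smul f g).
Proof.
by rewrite /smul /sscale /= !lmulZr; congr (_, _); rewrite -[LHS]lscaleD.
Qed.

Lemma smul_suml w w' (I : Type) (r : seq I) (F : I -> sfun R) u :
  (forall i, sbnd w (F i)) -> sbnd w' u ->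
  smul (\sum_(i <- r) F i) u = \sum_(i <- r) smul (F i) u.
Proof.
move=> bF bu; elim: r => [|i r IH]; first by rewrite !big_nil smul0l.
by rewrite !big_cons (smulDl (bF i) _ bu) ?IH //; apply: sbnd_sum.
Qed.

Lemma smul_sumr w w' (I : Type) (r : seq I) (F : I -> sfun R) u :
  (forall i, sbnd w (F i)) -> sbnd w' u ->
  smul u (\sum_(i <- r) F i) = \sum_(i <- r) smul u (F i).
Proof.
move=> bF bu; elim: r => [|i r IH]; first by rewrite !big_nil smul0r.
by rewrite !big_cons (smulDr (bF i) _ bu) ?IH //; apply: sbnd_sum.
Qed.

Lemma sbnd_sz : sbnd 2 (sz R).
Proof. by split=> k wk //=; case: eqP => // k1; lia. Qed.

Lemma sbnd_sth : sbnd 1 (sth R).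
Proof. by split=> k wk //=; case: eqP => // k1; lia. Qed.

(** Here [D z = theta] and [D theta = 1]. This is the case [n = 0] of the Leibniz formula
    [sD_iter_sz]. *)
Lemma sD_sz : sD (sz R) = smul (sth R) (sD (sth R)).
Proof.
have dz0 : ldz 0 = 0 :> lser R by apply: (addrI (ldz 0)); rewrite -ldzD !addr0.
rewrite !sDE /smul /=; congr (_, _); first by rewrite lmul0l.
have -> : ldz (fun=> g0 R) = 0 := dz0.
rewrite laddE lmul0r add0r.
have b1 : lbnd 0 (fun k => if k == 0 then g1 R else g0 R).
  by move=> k k0; case: eqP => // k1; lia.
apply/funext => k; rewrite (@lmulE _ 0 0 `|k|%N) //.
rewrite (bigD1_seq (0 : int)) ?zball_uniq ?mem_zball // subr0 eqxx.
rewrite big1 => [|i /negPf ->]; last by rewrite gmul0l.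
rewrite [RHS]addr0 gmul1l /ldz; case: (eqVneq k 0) => [->|k0].
  by apply/funext => S; rewrite /gscale add0r mul1r.
by case: eqP => [|_]; [lia|rewrite gscale0].
Qed.

End Superfunctions.

(** * The even superconformal vector field and its Leibniz formula *)

Section VectorField.
Variables (R : realType) (a m : lser R).
Hypotheses (a_even : forall i, grass_even (a i)) (a_bnd : lbnd 0 a).
Hypotheses (m_odd : forall i, grass_odd (m i)) (m_bnd : lbnd 0 m).
Implicit Types (f g u v : sfun R) (w : int).

(* The vector field [(a + theta m) d/dz + (m + theta a'/2) d/dtheta]. *)
Definition svf f : sfun R :=
  (lmul a (ldz f.1) + lmul m f.2,
   lmul a (ldz f.2) + lmul m (ldz f.1) + lscale 2^-1 (lmul (ldz a) f.2)).

(* [svf] plus the multiplication by [a'/2 + theta m']. *)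
Definition svf_twist f : sfun R :=
  (lmul a (ldz f.1) + lmul m f.2 + lscale 2^-1 (lmul (ldz a) f.1),
   lmul a (ldz f.2) + lmul m (ldz f.1) + lmul (ldz a) f.2 + lmul (ldz m) f.1).

Let fin_a : lfin a. Proof. by exists 0. Qed.
Let fin_m : lfin m. Proof. by exists 0. Qed.

(** Infinitesimal superconformality: the commutator of [D] with the field is a multiple of [D]. The
    first components agree by definition; in the second, the product rule for [ldz] produces the
    terms in [a'] and [m']. *)
Lemma sD_svf w f : sbnd w f -> sD (svf f) = svf_twist (sD f).
Proof.
move=> bf; have [f1 f2] := (sbnd_fin1 bf, sbnd_fin2 bf).
rewrite !sDE /svf /svf_twist /=; congr (_, _).
rewrite ldzD !ldzM; try by auto with lfin.
by apply/funext => k; apply/funext => S; rewrite !lserDE; ring.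
Qed.

(** The field is an even derivation, and the multiplier [a'/2 + theta m'] is even, so it may be
    moved past [u] onto [v]. *)
Lemma svf_twist_mul w w' u v : sbnd w u -> sbnd w' v ->
  svf_twist (smul u v) = smul (svf u) v + smul u (svf_twist v).
Proof.
move=> bu bv; have [u1 u2] := (sbnd_fin1 bu, sbnd_fin2 bu).
have [v1 v2] := (sbnd_fin1 bv, sbnd_fin2 bv).
have da := ldz_even a_even; have dm := ldz_odd m_odd.
(* These four rules bring every coefficient to the far left, at the cost of [lpar] when it is odd;
   the resulting normal forms are compared as linear expressions. *)
have ma (f g : lser R) : lfin f -> lfin g -> lmul f (lmul a g) = lmul a (lmul f g).
  by move=> ff fg; rewrite !lmulA // (lmulC_even f a_even).
have mda (f g : lser R) : lfin f -> lfin g ->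
    lmul f (lmul (ldz a) g) = lmul (ldz a) (lmul f g).
  by move=> ff fg; rewrite !lmulA; try by auto with lfin; rewrite (lmulC_even f da).
have mm (f g : lser R) : lfin f -> lfin g ->
    lmul f (lmul m g) = lmul m (lmul (lpar f) g).
  by move=> ff fg; rewrite !lmulA; try by auto with lfin; rewrite (lmulC_odd f m_odd).
have mdm (f g : lser R) : lfin f -> lfin g ->
    lmul f (lmul (ldz m) g) = lmul (ldz m) (lmul (lpar f) g).
  by move=> ff fg; rewrite !lmulA; try by auto with lfin; rewrite (lmulC_odd f dm).
rewrite /svf /svf_twist /smul /=; congr (_, _) => /=.
  rewrite !laddE ldzM; try by auto with lfin.
  rewrite !(lmulDl, lmulDr); try by auto 20 with lfin.
  rewrite lmulZr.
  rewrite -!lmulA; try by auto with lfin.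
  rewrite ma; try by auto with lfin.
  rewrite mm; try by auto with lfin.
  rewrite mda; try by auto with lfin.
  apply/funext => k; apply/funext => S; rewrite !(lserDE, lscaleE).
  by ring.
rewrite !laddE !lparD !lparM !lpar_dz (lpar_even a_even) (lpar_odd m_odd).
rewrite ldzD !ldzM; try by auto with lfin.
rewrite !(lmulDl, lmulDr); try by auto 20 with lfin.
rewrite !(lmulZl, lmulZr).
rewrite -!lmulA; try by auto with lfin.
(* [lmul] is made abstract because failed unification attempts would unfold it. *)
have [mul Emul] : exists mul, mul = @lmul R by exists (@lmul R).
rewrite -!Emul in ma mm mda mdm *.
rewrite !ma; try by auto with lfin.
rewrite !mm; try by auto with lfin.
rewrite !mda; try by auto with lfin.
rewrite mdm; try by auto with lfin.
rewrite !lparK.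
apply/funext => k; apply/funext => S; rewrite !(lserDE, lscaleE).
by field.
Qed.

(** As [a] and [m] have no positive powers of [z], the terms in [a] and [a'] lower the weight by at
    least 2, and those in [m], which exchange the two components, by at least 1. *)
Lemma sbnd_svf w f : sbnd w f -> sbnd (w - 1) (svf f).
Proof.
move=> [f0 f1]; split=> k wk; rewrite /svf /=; last first.
  rewrite -lmulZl.
  rewrite [LHS]/GRing.add /= [X in X + _]/GRing.add /= !lmul_eq0 ?addr0 // => i.
  (* The degree bound for [ldz a] must be -1 here: this term stays in the [theta] component without
     differentiating [f], so a bound of 0 would not lower the weight. *)
  - case: (ltP (-1) i) => i0; [left|right; apply: f1; lia].
    by rewrite /lscale /ldz a_bnd ?gscale0 //; lia.
  - case: (ltP 0 i) => i0; [by left; apply: m_bnd|right].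
    by rewrite /ldz f0 ?gscale0 //; lia.
  - case: (ltP 0 i) => i0; [by left; apply: a_bnd|right].
    by rewrite /ldz f1 ?gscale0 //; lia.
rewrite [LHS]/GRing.add /= !lmul_eq0 ?addr0 // => i.
- by case: (ltP 0 i) => i0; [left; apply: m_bnd|right; apply: f1; lia].
- case: (ltP 0 i) => i0; [by left; apply: a_bnd|right].
  by rewrite /ldz f0 ?gscale0 //; lia.
Qed.

Lemma sbnd_iter_svf w n f : sbnd w f -> sbnd (w - n%:Z) (iter n svf f).
Proof.
move=> bf; elim: n => [|n /sbnd_svf] /=; first by rewrite subr0.
by apply: sbndW; lia.
Qed.

Lemma svf_twist0 : svf_twist 0 = 0.
Proof.
have dz0 : ldz 0 = 0 :> lser R by apply: (addrI (ldz 0)); rewrite -ldzD !addr0.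
have sc0 : lscale 2^-1 0 = 0 :> lser R by apply/funext => k; apply: gscale0.
by rewrite /svf_twist /= dz0 !lmul0r sc0 !addr0.
Qed.

Lemma svf_twistD w f g : sbnd w f -> sbnd w g ->
  svf_twist (f + g) = svf_twist f + svf_twist g.
Proof.
move=> bf bg; have [f1 f2] := (sbnd_fin1 bf, sbnd_fin2 bf).
have [h1 h2] := (sbnd_fin1 bg, sbnd_fin2 bg).
rewrite /svf_twist /= !ldzD; congr (_, _) => /=; rewrite !lmulDr; try by auto with lfin.
  by apply/funext => k; apply/funext => S; rewrite !(lserDE, lscaleE); ring.
by apply/funext => k; apply/funext => S; rewrite !(lserDE, lscaleE); ring.
Qed.

Lemma svf_twistMn w f n : sbnd w f -> svf_twist (f *+ n) = svf_twist f *+ n.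
Proof.
move=> bf; elim: n => [|n IH]; first exact: svf_twist0.
by rewrite !mulrS (svf_twistD bf) ?IH //; apply: sbndMn.
Qed.

Lemma svf_twist_sum w (I : Type) (r : seq I) (F : I -> sfun R) :
  (forall i, sbnd w (F i)) ->
  svf_twist (\sum_(i <- r) F i) = \sum_(i <- r) svf_twist (F i).
Proof.
move=> bF; elim: r => [|i r IH]; first by rewrite !big_nil svf_twist0.
by rewrite !big_cons (svf_twistD (bF i)) ?IH //; apply: sbnd_sum.
Qed.

Lemma sD_iter_sz n : sD (iter n svf (sz R)) =
  \sum_(i < n.+1) smul (iter i svf (sth R)) (sD (iter (n - i) svf (sth R))) *+ 'C(n, i).
Proof.
have bth i : sbnd 1 (iter i svf (sth R)).
  by apply: sbndW (sbnd_iter_svf i (sbnd_sth R)); lia.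
have bDth i := sbnd_D (bth i).
elim: n => [|n IH].
  rewrite big_ord1 /= bin0 mulr1n; exact: sD_sz.
rewrite iterS (sD_svf (sbnd_iter_svf n (sbnd_sz R))) IH.
have bP i j := sbnd_mul (bth i) (bDth j).
(* A weight bound common to all terms: 1 for the iterates on [theta], and one less after [D]. *)
rewrite (@svf_twist_sum (1 + (1 - 1))) => [|i]; last by apply/sbndMn/bP.
(* By [svf_twist_mul] and [sD_svf], the twisted field raises one of the two exponents of each
   product, which is the pattern of Pascal's rule. *)
rewrite -(sum_binomS (fun i j => smul (iter i svf (sth R)) (sD (iter j svf (sth R))))).
apply: eq_bigr => i _; rewrite (svf_twistMn _ (bP _ _)).
by rewrite (svf_twist_mul (bth _) (bDth _)) -(sD_svf (bth _)).
Qed.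

End VectorField.

(** * The exponent of the exponential as a single vector field *)

Section GeneratingField.
Variable R : realType.
Implicit Types (A M C : int -> grass R) (f : sfun R) (j k w : int).

(* [\sum_(j < 0) C j z^(j+1)] *)
Definition neg_series C : lser R := fun k => if k < 1 then C (k - 1) else 0.

Lemma neg_seriesE C j : neg_series C (j + 1) = if j < 0 then C j else 0.
Proof. by rewrite /neg_series addrK; congr (if _ then _ else _); lia. Qed.

Lemma lbnd_neg_series C : lbnd 0 (neg_series C).
Proof. by move=> k k0; rewrite /neg_series; case: ifPn => //; lia. Qed.

Lemma neg_series_even C : (forall j, j < 0 -> grass_even (C j)) ->
  forall k, grass_even (neg_series C k).
Proof.
move=> eC k; rewrite /neg_series; case: ifPn => // k1.
by apply: eC; lia.
Qed.

Lemma neg_series_odd C : (forall j, j < 0 -> grass_odd (C j)) ->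
  forall k, grass_odd (neg_series C k).
Proof.
move=> eC k; rewrite /neg_series; case: ifPn => // k1.
by apply: eC; lia.
Qed.

Lemma Lvf1E j f k : (Lvf j f).1 k = gscale (-1) (ldz f.1 (k - (j + 1))).
Proof.
apply/funext => S; rewrite /Lvf /sadd /= /ladd /gadd /lscale /gscale /lzpow /g0.
by rewrite mulr0 addr0.
Qed.

Lemma Lvf2E j f k : (Lvf j f).2 k =
  gscale (-1) (ldz f.2 (k - (j + 1))) + gscale (- ((j + 1)%:~R / 2)) (f.2 (k - j)).
Proof. by []. Qed.

Lemma Gvf1E j f k : (Gvf j f).1 k = gscale (-1) (f.2 (k - (j + 1))).
Proof.
apply/funext => S; rewrite /Gvf /sscale /= /lzpow /ladd /gadd /lscale /gscale /g0.
by rewrite mulr0 addr0.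
Qed.

Lemma Gvf2E j f k : (Gvf j f).2 k = ldz f.1 (k - (j + 1)).
Proof.
apply/funext => S; rewrite /Gvf /sscale /= /lzpow /ladd /gadd /lscale /gscale /g0.
by rewrite add0r mulrA mulrNN !mul1r.
Qed.

Lemma fsum_neg (F : int -> Cx R) n :
  (forall j, j < 0 -> (n < `|j|)%N -> F j = 0) ->
  \sum_(j \in [set j : int | j < 0]%classic) F j =
  \sum_(j <- zball n) if j < 0 then F j else 0.
Proof.
move=> F0; have patchE j : patch (fun=> 0) [set j : int | j < 0]%classic F j =
    if j < 0 then F j else 0.
  rewrite /patch; case: ifPn => [|]; first by rewrite inE /= => ->.
  by rewrite notin_setE /= => /negP/negPf ->.
rewrite fsbig_mkcond (@fsum_zball _ _ n); first by apply: eq_bigr => j _.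
by move=> j nj; rewrite patchE; case: ifPn => // /F0 ->.
Qed.

Lemma Xop1E A M f k S : (Xop A M f).1 k S =
  -1 * \sum_(j \in [set j : int | j < 0]%classic)
    (gmul (A j) ((Lvf j f).1 k) S + gmul (M j) ((Gvf j f).1 k) S).
Proof. by []. Qed.

Lemma Xop2E A M f k S : (Xop A M f).2 k S =
  -1 * \sum_(j \in [set j : int | j < 0]%classic)
    (gmul (gpar (A j)) ((Lvf j f).2 k) S + gmul (gpar (M j)) ((Gvf j f).2 k) S).
Proof. by []. Qed.

(** The minus sign of the exponent cancels those of the generators. In the [theta] component, [Gvf]
    carries a plus sign instead, and the missing sign comes from moving the odd [M j] past
    [theta]. *)
Lemma Xop_svf A M w f :
  (forall j, j < 0 -> grass_even (A j)) -> (forall j, j < 0 -> grass_odd (M j)) ->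
  sbnd w f -> Xop A M f = svf (neg_series A) (neg_series M) f.
Proof.
move=> eA oM bf; have [f1 f2] := (sbnd1 bf, sbnd2 bf).
have d1 := lbnd_dz f1; have d2 := lbnd_dz f2.
have [bA bM] := (@lbnd_neg_series A, @lbnd_neg_series M).
rewrite [LHS]surjective_pairing /svf; congr (_, _); apply/funext => k.
  pose n := (`|w| + `|k| + 2)%N.
  apply/funext => S; rewrite Xop1E lserDE.
  (* The shift by 1 matches the index [j] with the power [z^(j+1)] that multiplies [A j] or
     [M j]. *)
  rewrite (@lmulE_shift _ 0 `|w|%N n _ _ _ 1) //; last by rewrite /n; lia.
  rewrite (@lmulE_shift _ 0 `|w|%N n _ _ _ 1) //; last by rewrite /n; lia.
  rewrite (@fsum_neg _ n) => [|j j0 nj].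
    rewrite !fct_sumE -big_split mulr_sumr; apply: eq_bigr => j _.
    rewrite Lvf1E Gvf1E /= !neg_seriesE; case: ifPn => [j0|_]; last first.
      by rewrite !gmul0l mulr0 addr0.
    by rewrite !gmulZr /gscale; ring.
  rewrite Lvf1E Gvf1E d1 ?f2; try by rewrite /n in nj; lia.
  by rewrite gscale0 !gmul0r addr0.
pose n := (`|w| + `|k| + 2)%N.
apply/funext => S; rewrite Xop2E !lserDE lscaleE.
rewrite (@lmulE_shift _ 0 `|w|%N n _ _ _ 1) //; last by rewrite /n; lia.
rewrite (@lmulE_shift _ 0 `|w|%N n _ _ _ 1) //; last by rewrite /n; lia.
(* No shift for [ldz] of the series of [A]: its coefficient at [j] is already [(j + 1) A j], the
   factor in the second term of [Lvf]. *)
rewrite (@lmulE _ 0 `|w|%N n _ _ _) //; [|exact: lbnd_dz|by rewrite /n; lia].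
rewrite (@fsum_neg _ n) => [|j j0 nj].
  rewrite !fct_sumE [X in _ + X]mulr_sumr -!big_split mulr_sumr; apply: eq_bigr => j _.
  rewrite Lvf2E Gvf2E /= /ldz !neg_seriesE; case: ifPn => [j0|_]; last first.
    by rewrite gscale0 !gmul0l !mulr0 !addr0.
  rewrite (gpar_even (eA _ j0)) (gpar_odd (oM _ j0)).
  by rewrite gmulDr !gmulZr !gmulZl grassDE /gscale; field.
rewrite Lvf2E Gvf2E d1 ?d2 ?f2; try by rewrite /n in nj; lia.
by rewrite !gscale0 addr0 !gmul0r addr0.
Qed.

End GeneratingField.

(** * The exponential and its partial sums *)

Section Exponential.
Variables (R : realType) (A M : int -> grass R).
Hypothesis A_even : forall j : int, j < 0 -> grass_even (A j).
Hypothesis M_odd : forall j : int, j < 0 -> grass_odd (M j).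
Implicit Types (f g : sfun R) (w k : int).

Let X := svf (neg_series A) (neg_series M).

Definition exp_psum N f : sfun R :=
  \sum_(n < N) sscale (n`!%:R)^-1 (iter n X f).

Let sbnd_iterX w n f : sbnd w f -> sbnd (w - n%:Z) (iter n X f).
Proof. by apply: sbnd_iter_svf; apply: lbnd_neg_series. Qed.

Lemma iter_Xop w n f : sbnd w f -> iter n (Xop A M) f = iter n X f.
Proof.
move=> bf; elim: n => //= n ->.
exact: Xop_svf A_even M_odd (sbnd_iterX n bf).
Qed.

Lemma sum_fstE (I : Type) (r : seq I) (F : I -> sfun R) k S :
  (\sum_(i <- r) F i).1 k S = \sum_(i <- r) (F i).1 k S.
Proof. by elim: r => [|i r IH]; rewrite ?big_nil // !big_cons -IH. Qed.

Lemma sum_sndE (I : Type) (r : seq I) (F : I -> sfun R) k S :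
  (\sum_(i <- r) F i).2 k S = \sum_(i <- r) (F i).2 k S.
Proof. by elim: r => [|i r IH]; rewrite ?big_nil // !big_cons -IH. Qed.

(** From the [N]-th term on, the weight is at most [w - N], too low to reach [z^k]. *)
Lemma Eop1E w N f k : sbnd w f -> w - N%:Z < k *+ 2 ->
  (Eop A M f).1 k = (exp_psum N f).1 k.
Proof.
move=> bf wk; apply/funext => S; rewrite sum_fstE.
rewrite /Eop /ssum /= (@fsum_nat _ _ N) => [|n Nn].
  by apply: eq_bigr => n _; rewrite (iter_Xop n bf).
have [+ _] := sbnd_iterX n bf; rewrite (iter_Xop n bf) /lscale /gscale => ->.
  exact: mulr0.
by lia.
Qed.

Lemma Eop2E w N f k : sbnd w f -> w - N%:Z < k *+ 2 + 1 ->
  (Eop A M f).2 k = (exp_psum N f).2 k.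
Proof.
move=> bf wk; apply/funext => S; rewrite sum_sndE.
rewrite /Eop /ssum /= (@fsum_nat _ _ N) => [|n Nn].
  by apply: eq_bigr => n _; rewrite (iter_Xop n bf).
have [_ +] := sbnd_iterX n bf; rewrite (iter_Xop n bf) /lscale /gscale => ->.
  exact: mulr0.
by lia.
Qed.

Lemma sbnd_Eop w f : sbnd w f -> sbnd w (Eop A M f).
Proof.
(* Above weight [w] even the empty partial sum is exact. *)
move=> bf; split=> k wk; [rewrite (@Eop1E w 0)|rewrite (@Eop2E w 0)] => //;
  by rewrite ?subr0 // /exp_psum big_ord0.
Qed.

Lemma sbnd_exp_psum w N f : sbnd w f -> sbnd w (exp_psum N f).
Proof.
move=> bf; apply: sbnd_sum => n; apply: sbndZ.
by apply: sbndW (sbnd_iterX n bf); lia.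
Qed.

Let P i j := smul (iter i X (sth R)) (sD (iter j X (sth R))).

Lemma exp_psum_superconformal (e : sfun R -> Cx R) N :
  {morph e : f g / f + g} -> (forall x f, e (sscale x f) = x * e f) ->
  (forall i j, (N <= i + j)%N -> e (P i j) = 0) ->
  e (sD (exp_psum N (sz R))) =
  e (smul (exp_psum N (sth R)) (sD (exp_psum N (sth R)))).
Proof.
move=> eD eZ eP.
have e0 : e 0 = 0 by apply: (addrI (e 0)); rewrite -eD !addr0.
have eMn f n : e (f *+ n) = e f *+ n.
  by elim: n => [|n IH]; rewrite ?mulr0n // !mulrS eD IH.
have eS (I : Type) (r : seq I) F : e (\sum_(i <- r) F i) = \sum_(i <- r) e (F i).
  by elim: r => [|i r IH]; rewrite ?big_nil // !big_cons eD IH.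
have bth i : sbnd 1 (iter i X (sth R)).
  by apply: sbndW (sbnd_iterX i (sbnd_sth R)); lia.
have bE := sbnd_exp_psum N (sbnd_sth R).
pose G i j := (i`!%:R)^-1 * (j`!%:R)^-1 * e (P i j).
transitivity (\sum_(n < N) \sum_(i < n.+1) G i (n - i)%N).
  rewrite /exp_psum sD_sum eS; apply: eq_bigr => n _.
  rewrite sDZ eZ sD_iter_sz; try exact: lbnd_neg_series.
  - rewrite eS mulr_sumr; apply: eq_bigr => i _.
    (* Writing [n!] as ['C(n, i) * (i! * (n - i)!)] turns the binomial weights into those of a
       product of exponentials. *)
    rewrite eMn /G -/(P _ _) -mulr_natr -(@bin_fact n i) -1?ltnS // !natrM.
    have Cn0 : 'C(n, i)%:R != 0 :> Cx R by rewrite pnatr_eq0 -lt0n bin_gt0 -ltnS.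
    have f0 m : m`!%:R != 0 :> Cx R by rewrite pnatr_eq0 -lt0n fact_gt0.
    by field; rewrite Cn0 !f0.
  - exact: neg_series_even.
  - exact: neg_series_odd.
rewrite -sum_square => [|i j /eP eP0]; last by rewrite /G eP0 mulr0.
rewrite (@smul_suml _ 1 _ _ _ _ _ _ (sbnd_D bE)) => [|i]; last exact/sbndZ/bth.
rewrite eS; apply: eq_bigr => i _.
rewrite smulZl eZ /exp_psum sD_sum.
rewrite (@smul_sumr _ (1 - 1) _ _ _ _ _ _ (bth i)) => [|j]; last first.
  by rewrite sDZ; apply/sbndZ/sbnd_D/bth.
rewrite eS mulr_sumr; apply: eq_bigr => j _.
by rewrite sDZ smulZr eZ /G mulrA.
Qed.

End Exponential.

(** * Superconformality, coefficient by coefficient *)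

Theorem theorem3p1 (R : realType) (ngen : option nat) (A M : int -> grass R) :
  (forall j : int, (j < 0)%R -> grass_elt ngen (A j) /\ grass_even (A j)) ->
  (forall j : int, (j < 0)%R -> grass_elt ngen (M j) /\ grass_odd (M j)) ->
  let zt := Eop A M (sz R) in
  let tht := Eop A M (sth R) in
  sD zt = smul tht (sD tht).
Proof.
move=> hA hM zt tht.
have eA j : j < 0 -> grass_even (A j) by move=> /hA[].
have oM j : j < 0 -> grass_odd (M j) by move=> /hM[].
have bP i j := sbnd_mul
  (sbnd_iter_svf (@lbnd_neg_series _ A) (@lbnd_neg_series _ M) i (sbnd_sth R))
  (sbnd_D (sbnd_iter_svf (@lbnd_neg_series _ A) (@lbnd_neg_series _ M) j (sbnd_sth R))).
have bt := sbnd_Eop eA oM (sbnd_sth R).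
have bDt := sbnd_D bt.
rewrite [LHS]surjective_pairing [RHS]surjective_pairing.
(* With this [N], terms of order at least [N] cannot affect coefficients of index [k - 3] or more.
   As [tht] and its derivative have degree at most 1, the coefficient of their product at [k]
   involves only such indices, with room to spare. *)
congr (_, _); apply/funext => k; pose N := (2 * `|k| + 20)%N.
all: have bp := sbnd_exp_psum A M N (sbnd_sth R).
all: have bDp := sbnd_D bp.
all: have t1 (i : int) : k - 3 <= i -> tht.1 i = (exp_psum A M N (sth R)).1 i
  by move=> ki; apply: (Eop1E eA oM (sbnd_sth R)); rewrite /N; lia.
all: have t2 (i : int) : k - 3 <= i -> tht.2 i = (exp_psum A M N (sth R)).2 i
  by move=> ki; apply: (Eop2E eA oM (sbnd_sth R)); rewrite /N; lia.
all: have D1 (i : int) : k - 3 <= i ->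
  (sD tht).1 i = (sD (exp_psum A M N (sth R))).1 i by rewrite !sDE; apply: t2.
all: have D2 (i : int) : k - 3 <= i ->
  (sD tht).2 i = (sD (exp_psum A M N (sth R))).2 i
  by move=> ki; rewrite !sDE; congr (gscale _ _); apply: t1; lia.
- have -> : (sD zt).1 k = (sD (exp_psum A M N (sz R))).1 k.
    by rewrite !sDE; apply: (Eop2E eA oM (sbnd_sz R)); rewrite /N; lia.
  have -> : (smul tht (sD tht)).1 k =
      (smul (exp_psum A M N (sth R)) (sD (exp_psum A M N (sth R)))).1 k.
    apply: (lmul_congr (sbnd1 bt) (sbnd1 bp) (sbnd1 bDt) (sbnd1 bDp) _ _ t1 D1);
      lia.
  apply/funext => S.
  (* The product of orders [i] and [j] has weight at most [1 - i - j], hence too low for the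
     coefficient at [k] once [N <= i + j]. *)
  apply: (exp_psum_superconformal eA oM (e := fun f => f.1 k S)) => // i j Nij.
  by have [-> //] := bP i j; rewrite /N in Nij; lia.
- have -> : (sD zt).2 k = (sD (exp_psum A M N (sz R))).2 k.
    rewrite !sDE; congr (gscale _ _).
    by apply: (Eop1E eA oM (sbnd_sz R)); rewrite /N; lia.
  have -> : (smul tht (sD tht)).2 k =
      (smul (exp_psum A M N (sth R)) (sD (exp_psum A M N (sth R)))).2 k.
    congr (gadd _ _).
      apply: (lmul_congr (lbnd_par (sbnd1 bt)) (lbnd_par (sbnd1 bp))
                (sbnd2 bDt) (sbnd2 bDp) _ _ _ D2); try lia.
      by move=> i ki; rewrite /lpar t1.
    by apply: (lmul_congr (sbnd2 bt) (sbnd2 bp) (sbnd1 bDt) (sbnd1 bDp) _ _ t2 D1);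
      lia.
  apply/funext => S.
  apply: (exp_psum_superconformal eA oM (e := fun f => f.2 k S)) => // i j Nij.
  by have [_ -> //] := bP i j; rewrite /N in Nij; lia.
Qed.
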